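(* Let $n\ge 2$, let $S\subset\mathbb{R}^n$ be a nonempty locally closed subset, and let $\{L_1,L_2,\ldots\}$ and $\{L'_1,L'_2,\ldots\}$ be disjoint (countable) collections of distinct closed subsets of $S$ (closed in the relative topology of $S$), each of which is contained in a rational affine hyperplane in $\mathbb{R}^n$. For each $i$ let $A_i$ be a rational affine hyperplane containing $L_i$. Assume the following, where closures are taken in $S$: (a) $\bigcup_i L_i\cup\bigcup_j L'_j=\{\boldsymbol{x}\in S:\ \boldsymbol{x}\text{ is contained in a rational affine hyperplane}\}$; (b) for each $i$ and each $T>0$, $L_i=\overline{\bigcup_{j:\,|A_j|>T}(L_i\cap L_j)}$; (c) for each $i$ and for any finite sets of indices $F,F'$ with $i\notin F$, $L_i=\overline{L_i\smallsetminus\left(\bigcup_{k\in F}L_k\cup\bigcup_{k'\in F'}L'_{k'}\right)}$; (d) $\bigcup_i L_i$ is dense in $S$. Then for every function $\Phi:\mathbb{Z}^n\smallsetminus\{\boldsymbol{0}\}\to\mathbb{R}_+$ such that for every $C>0$ the set $\{\boldsymbol{q}\in\mathbb{Z}^n\smallsetminus\{\boldsymbol 0\}:\Phi(\boldsymbol{q})\le C\}$ is finite, and for every non-increasing function $\varphi:\mathbb{R}_+\to\mathbb{R}_+$, there exist uncountably many totally irrational $\boldsymbol{\xi}\in S$ such that $\psi_{\Phi,\boldsymbol{\xi}}(t)\le\varphi(t)$ for all large enough $t$.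
   Context: $\mathbb{R}_+$ denotes the positive real numbers. A set $S\subset\mathbb{R}^n$ is locally closed if there is an open set $\mathcal{W}\subset\mathbb{R}^n$ with $S=\overline{S}\cap\mathcal{W}$. For a primitive vector $\mathbf{m}=(m_0,m_1,\ldots,m_n)\in\mathbb{Z}^{n+1}$ with $(m_1,\ldots,m_n)\neq 0$, put $A_{\mathbf{m}}=\{\boldsymbol{\xi}\in\mathbb{R}^n:\sum_{i=1}^n m_i\xi_i=m_0\}$ and $|A_{\mathbf{m}}|=\|(m_1,\ldots,m_n)\|$, where $\|\boldsymbol{x}\|=\max_j|x_j|$. The sets $A_{\mathbf{m}}$ are the rational affine hyperplanes of $\mathbb{R}^n$ (the vector $\mathbf{m}$ is determined up to sign, so $|A|$ is well defined for every rational affine hyperplane $A$). A vector $\boldsymbol{\xi}=(\xi_1,\ldots,\xi_n)\in\mathbb{R}^n$ is totally irrational if $1,\xi_1,\ldots,\xi_n$ are linearly independent over $\mathbb{Q}$. For $x\in\mathbb{R}$, $\langle x\rangle$ denotes the distance from $x$ to the nearest integer, and $\boldsymbol{x}\cdot\boldsymbol{y}=x_1y_1+\cdots+x_ny_n$. The irrationality measure function is $$\psi_{\Phi,\boldsymbol{\xi}}(t)=\min\{\langle\boldsymbol{q}\cdot\boldsymbol{\xi}\rangle:\ \boldsymbol{q}\in\mathbb{Z}^n\smallsetminus\{\boldsymbol{0}\},\ \Phi(\boldsymbol{q})\le t\},$$ defined for all $t$ large enough that the set over which the minimum is taken is nonempty. *)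

(* Defs.v *)
From HB Require Import structures.
From mathcomp Require Import all_boot all_order all_algebra.
From mathcomp Require Import all_classical all_reals all_analysis.

Set Implicit Arguments.
Unset Strict Implicit.
Unset Printing Implicit Defensive.
Import Order.TTheory GRing.Theory Num.Theory.
Import numFieldNormedType.Exports.
Local Open Scope classical_set_scope.
Local Open Scope ring_scope.

Section topology.
Context {T : topologicalType}.

Definition locally_closed (S : set T) :=
  exists2 W : set T, open W & S = closure S `&` W.

Definition closed_in (S B : set T) :=
  exists2 C : set T, closed C & B = S `&` C.

(* The closure in the relative topology of S, for B contained in S. *)
Definition closure_in (S B : set T) : set T := S `&` closure B.

End topology.

Section hyperplanes.

(* The vector (m_0, m_1, .., m_n) is m : 'rV[int]_n.+1, so that m_0 is
   m 0 ord0 and (m_1, .., m_n) is the following. *)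
Definition normal_part n (m : 'rV[int]_n.+1) : 'rV[int]_n :=
  \row_i m 0 (lift ord0 i).

Definition primitive n (m : 'rV[int]_n) : Prop :=
  \big[gcdn/0%N]_(i < n) absz (m 0 i) = 1%N.

Definition sup_norm n (a : 'rV[int]_n) : nat := \max_(i < n) absz (a 0%R i).

Context {R : realType} {n : nat}.

Definition hyperplane_of (m : 'rV[int]_n.+1) : set 'rV[R]_n :=
  [set xi | \sum_(i < n) (normal_part m 0 i)%:~R * xi 0 i = (m 0 ord0)%:~R].

Definition defines_hyperplane (m : 'rV[int]_n.+1) (A : set 'rV[R]_n) : Prop :=
  [/\ primitive m, normal_part m != 0 & A = hyperplane_of m].

Definition rational_hyperplane (A : set 'rV[R]_n) : Prop :=
  exists m, defines_hyperplane m A.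

(* |A|, with the junk value 0 if A is not a rational affine hyperplane;
   see heightE. *)
Definition height (A : set 'rV[R]_n) : nat :=
  xget 0%N [set h | exists2 m, defines_hyperplane m A
                             & h = sup_norm (normal_part m)].

Lemma hyperplane_of_prop (m m' : 'rV[int]_n.+1) (k : 'I_n) :
    normal_part m 0 k != 0 ->
    hyperplane_of m `<=` hyperplane_of m' ->
  forall i, m' 0 i * normal_part m 0 k = m 0 i * normal_part m' 0 k.
Proof.
set a := normal_part m; set a' := normal_part m' => ak0 sub.
have ak0R : (a 0 k)%:~R != 0 :> R by rewrite intr_eq0.
have sum_delta (b : 'rV[int]_n) j (c : R) :
    \sum_(i < n) (b 0 i)%:~R * (c * (i == j)%:R) = c * (b 0 j)%:~R.
  rewrite (bigD1 j) //= eqxx mulr1 big1 ?addr0 1?mulrC // => i /negPf ->.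
  by rewrite !mulr0.
pose c : R := (m 0 ord0)%:~R / (a 0 k)%:~R.
have E0 : c * (a' 0 k)%:~R = (m' 0 ord0)%:~R.
  have : hyperplane_of m (\row_i (c * (i == k)%:R)).
    rewrite /hyperplane_of /= -/a; under eq_bigr do rewrite mxE.
    by rewrite sum_delta /c divfK.
  move=> /sub; rewrite /hyperplane_of /= -/a'.
  by under eq_bigr do rewrite mxE; rewrite sum_delta.
move=> i; case: (unliftP ord0 i) => [j ->|->]; last first.
  apply: (@intr_inj R); rewrite !intrM -E0 /c mulrAC divfK //.
have -> : m' 0 (lift ord0 j) = a' 0 j by rewrite mxE.
have -> : m 0 (lift ord0 j) = a 0 j by rewrite mxE.
pose d : R := - (a 0 j)%:~R.
have : hyperplane_of m (\row_i (c * (i == k)%:R +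
    ((a 0 k)%:~R * (i == j)%:R + d * (i == k)%:R))).
  rewrite /hyperplane_of /= -/a; under eq_bigr do rewrite mxE !mulrDr.
  rewrite !big_split /= !sum_delta /c divfK // /d mulNr.
  by rewrite [X in X - _]mulrC subrr addr0.
move=> /sub; rewrite /hyperplane_of /= -/a'.
under eq_bigr do rewrite mxE !mulrDr.
rewrite !big_split /= !sum_delta E0 => /(canRL (addKr _)).
rewrite addNr /d mulNr => /eqP; rewrite subr_eq0 => /eqP E.
by apply: (@intr_inj R); rewrite !intrM [LHS]mulrC.
Qed.

Lemma heightE (m : 'rV[int]_n.+1) (A : set 'rV[R]_n) :
  defines_hyperplane m A -> height A = sup_norm (normal_part m).
Proof.
move=> mA; apply: xget_unique; first by exists m.
move=> _ [m' [pm' _ AE'] ->]; case: mA => pm a0 AE.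
have [k ak0] : exists k, normal_part m 0 k != 0.
  by apply/rV0Pn.
have P i : (absz (m' 0%R i) * absz (normal_part m 0%R k) =
            absz (m 0%R i) * absz (normal_part m' 0%R k))%N.
  by rewrite -!abszM (hyperplane_of_prop ak0) // -AE AE'.
have distr (b : 'rV[int]_n.+1) (c : nat) :
    \big[gcdn/0%N]_(i < n.+1) (absz (b 0%R i) * c)%N =
    (\big[gcdn/0%N]_(i < n.+1) absz (b 0%R i) * c)%N.
  by rewrite (@big_morph _ _ (muln^~ c) 0%N gcdn) // => x y; rewrite muln_gcdl.
have E : absz (normal_part m 0 k) = absz (normal_part m' 0 k).
  have := distr m' (absz (normal_part m 0 k)); rewrite pm' mul1n => <-.
  by under eq_bigr do rewrite P; rewrite distr pm mul1n.
apply: eq_bigr => i _; rewrite !mxE; apply/eqP.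
by rewrite -(@eqn_pmul2r (absz (normal_part m 0 k))) ?absz_gt0 // P E.
Qed.

End hyperplanes.

Section irrationality_measure.
Context {R : realType} {n : nat}.

Definition totally_irrational (xi : 'rV[R]_n) : Prop :=
  forall (c0 : rat) (c : 'rV[rat]_n),
    ratr c0 + \sum_(i < n) ratr (c 0 i) * xi 0 i = 0 -> c0 = 0 /\ c = 0.

Definition dist_int (x : R) : R := inf [set `|x - k%:~R| | k in [set: int]].

Definition dotZ (q : 'rV[int]_n) (xi : 'rV[R]_n) : R :=
  \sum_(i < n) (q 0 i)%:~R * xi 0 i.

Definition psi_values (Phi : 'rV[int]_n -> R) (xi : 'rV[R]_n) (t : R) : set R :=
  [set dist_int (dotZ q xi) | q in [set q : 'rV[int]_n | q != 0 /\ Phi q <= t]].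

(* The minimum of psi_values Phi xi t; the junk value 0 is returned if there
   is no minimum. Only the values of Phi outside 0 matter. See psiP and
   psi_values_neq0. *)
Definition psi (Phi : 'rV[int]_n -> R) (xi : 'rV[R]_n) (t : R) : R :=
  xget 0 [set y | psi_values Phi xi t y /\ lbound (psi_values Phi xi t) y].

Lemma psiP (Phi : 'rV[int]_n -> R) (xi : 'rV[R]_n) (t : R) :
    finite_set [set q : 'rV[int]_n | q != 0 /\ Phi q <= t] ->
    psi_values Phi xi t !=set0 ->
  psi_values Phi xi t (psi Phi xi t) /\
  lbound (psi_values Phi xi t) (psi Phi xi t).
Proof.
move=> fin [y0 Vy0].
suff : exists y, psi_values Phi xi t y /\ lbound (psi_values Phi xi t) y.
  exact: xgetPex.
have /finite_seqP[s Vs] : finite_set (psi_values Phi xi t).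
  exact: finite_image.
move: Vy0; rewrite Vs /= => y0s.
have [i _ Hi] := @arg_minP _ R 'I_(size s)
  (Ordinal (etrans (index_mem y0 s) y0s)) predT (fun i => s`_i) isT.
exists s`_i; split; first exact: mem_nth.
move=> y /= ys; rewrite -(nth_index 0 ys).
by have := Hi (Ordinal (etrans (index_mem y s) ys)) isT.
Qed.

Lemma psi_values_neq0 (Phi : 'rV[int]_n -> R) (xi : 'rV[R]_n) :
  (0 < n)%N -> \forall t \near +oo, psi_values Phi xi t !=set0.
Proof.
move=> n_gt0; near=> t; exists (dist_int (dotZ (const_mx 1) xi)).
exists (const_mx 1) => //; split.
  by apply/rV0Pn; exists (Ordinal n_gt0); rewrite mxE.
by near: t; apply: nbhs_pinfty_ge; exact: num_real.
Unshelve. all: by end_near. Qed.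

End irrationality_measure.

(* Main.v *)
Require Import Defs.
From mathcomp Require Import all_boot all_order all_algebra.
From mathcomp Require Import all_classical all_reals all_analysis.
Import Order.TTheory GRing.Theory Num.Theory.
Import numFieldNormedType.Exports.
Local Open Scope classical_set_scope.
Local Open Scope ring_scope.

(** The theorem is proved by the nested-set construction of Khintchine.  Write
    q_i for the normal vector of A_i.  On L_i the number q_i . xi is an integer,
    so near any point of L_i the distance of q_i . xi to the integers is as
    small as desired; that is how good approximations are produced
    ([near_hyperplane]).

    One builds open sets U_0, U_1, ... with the closure of U_(k+1) inside U_k,
    and indices i_k, such that U_k meets L_(i_k).  Given U_k and i_k, density of
    the intersections L_(i_k) /\ L_j with |A_j| large (hypothesis (b)) gives
    j = i_(k+1) with L_(i_k) /\ L_j meeting U_k at some x and with Phi(q_j)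
    larger than Phi(q_(i_k)) + 1, as only finitely many q have bounded Phi.
    Since x lies on L_(i_k), the distance of q_(i_k) . y to the integers is at
    most phi(Phi(q_j)) for y near x; since x also lies on L_j, hypothesis (c)
    gives, arbitrarily near x, a point of L_j off any prescribed finite
    collection of the other L_l and of the L'_l.  A small neighbourhood of that
    point is U_(k+1) ([open_refinement]).

    By local compactness there is a point xi of S in all U_k.  A given L'_l is
    avoided from some step on; a given L_l, from some step on, is avoided at
    each step that does not choose the index l, hence at least once, as
    consecutive indices differ.  By (a), xi lies on no rational affine
    hyperplane, hence is totally irrational.  If
    Phi(q_(i_k)) <= t < Phi(q_(i_(k+1))), then
    psi(t) <= <q_(i_k) . xi> <= phi(Phi(q_(i_(k+1)))) <= phi(t), and these
    intervals cover all large t.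

    For uncountability, suppose that the set of all such xi were countable.  A
    totally irrational point lies on no L_j, so it can be avoided as well, one
    point at each step; the construction then yields a xi outside that set, a
    contradiction.  The topological part is [nested_refinement]. *)

(** * Nested neighbourhoods along a family of closed sets *)

Lemma closed_in_setI_closure {T : topologicalType} (S B : set T) :
  closed_in S B -> S `&` closure B = B.
Proof.
move=> [C Cc BE]; apply/seteqP; split=> [x [Sx Bx]|x Bx].
  rewrite BE; split=> //; apply: Cc.
  by apply: closureS Bx; rewrite BE => y [].
by split; [move: Bx; rewrite BE => -[] | exact: subset_closure].
Qed.

Lemma regular_open_shrink {T : topologicalType} (x : T) (V : set T) :
  regular_space T -> nbhs x V ->
  exists U, [/\ open U, U x & closure U `<=` V].
Proof.
move=> /(_ x V) reg /reg [B nB BV].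
exists (B°); split; first exact: open_interior.
  by [].
by apply: subset_trans BV; apply: closureS; exact: interior_subset.
Qed.

(** The limit lies in the sets U k and not only in their closures, because the
    closure of U k.+1 is inside U k. *)
Lemma nested_open_compact {T : topologicalType} (S K : set T)
    (U : nat -> set T) :
    compact K -> U 0%N `<=` K -> (forall k, closure (U k.+1) `<=` U k) ->
    (forall k, U k `&` S !=set0) ->
  exists p, [/\ closure S p, K p & forall k, U k p].
Proof.
move=> cK U0K clU /choice[z /all_and2[Uz Sz]].
have decU m k : (m <= k)%N -> U k `<=` U m.
  move=> /subnK <-; elim: (k - m)%N => [//|d IH] x Ux.
  by apply: IH; apply: clU; exact: subset_closure.
have near_U m : \forall k \near \oo, U m (z k).
  by exists m => // k /= mk; exact: decU mk _ (Uz k).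
have [p [Kp clp]] : K `&` cluster (z @ \oo) !=set0.
  by apply: cK; apply: filterS (near_U 0%N) => k; exact: U0K.
exists p; split.
- move=> B nB; apply: (clp S B _ nB).
  by exists 0%N => // k _; exact: Sz.
- by [].
- move=> k; apply: clU => B nB; apply: clp nB; exact: near_U.
Qed.

Lemma rV_nbhs_compact {R : realType} {n : nat} (x : 'rV[R]_n)
    (W : set 'rV[R]_n) :
  nbhs x W -> exists K, [/\ compact K, nbhs x K & K `<=` W].
Proof.
move=> /nbhs_closedballP[r rW]; exists (closed_ball x r%:num); split=> //.
  apply: bounded_closed_compact; last exact: closed_ball_closed.
  exists (`|x| + r%:num); split; first exact: num_real.
  move=> M ltM y; rewrite closed_ballE // /closed_ball_ /= => xy.
  apply: le_trans (ltW ltM); rewrite -[y](subKr x).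
  by apply: le_trans (ler_normB _ _) _; rewrite lerD2l.
by apply/nbhs_closedballP; exists r.
Qed.

(** Dependent choice for a relation that also depends on the number of the step:
    successive neighbourhoods must avoid more and more sets of a sequence. *)
Lemma dependent_choice_nat {X : Type} (P : X -> Prop)
    (Q : nat -> X -> X -> Prop) (x0 : X) :
    P x0 -> (forall k x, P x -> exists2 y, P y & Q k x y) ->
  exists f : nat -> X, forall k, P (f k) /\ Q k (f k) (f k.+1).
Proof.
move=> Px0 step.
have [|f [f0 /all_and2[fS fQ]]] := @dependent_choice (nat * {x | P x})
    (fun a b => b.1 = a.1.+1 /\ Q a.1 (sval a.2) (sval b.2)) _
    (0%N, exist P x0 Px0).
  move=> [k [x Px]]; apply: cid; have [y Py Qy] := step k x Px.
  by exists (k.+1, exist P y Py).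
have fE k : (f k).1 = k by elim: k => [|k IH]; [rewrite f0 | rewrite fS IH].
exists (fun k => sval (f k).2) => k; split; first exact: svalP.
by rewrite -{1}(fE k).
Qed.

(** A point of both L i and L j in U has a neighbourhood inside G j; it need not
    be off E j, but it is a limit of points of L j that are. *)
Lemma open_refinement {T : topologicalType} {I : Type} (regT : regular_space T)
    (L : I -> set T) (i : I) (U : set T) (J : set I) (G E : I -> set T) :
    open U -> U `&` L i !=set0 ->
    L i `<=` closure (\bigcup_(j in J) (L i `&` L j)) ->
    (forall j x, J j -> L i x -> nbhs x (G j)) ->
    (forall j, J j -> closed (E j)) ->
    (forall j, J j -> L j `<=` closure (L j `\` E j)) ->
  exists j U', [/\ J j, open U', U' `&` L j !=set0, closure U' `<=` U &
                 U' `<=` G j `\` E j].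
Proof.
move=> oU [x [Ux Lix]] Hb nG cE Hc.
have [y [[j Jj [Liy Ljy]] Uy]] := Hb x Lix U (open_nbhs_nbhs (conj oU Ux)).
have nV : nbhs y (U `&` (G j)°).
  apply: filterI; first exact: open_nbhs_nbhs.
  by apply: nbhs_interior; exact: nG.
have [z [[Ljz Ejz] [Uz Gz]]] := Hc j Jj y Ljy _ nV.
have nV' : nbhs z (U `&` G j `&` ~` E j).
  apply: filterI; last first.
    by apply: open_nbhs_nbhs; split => //; exact/closed_openC/cE.
  by apply: filterI => //; exact: open_nbhs_nbhs.
have [U' [oU' U'z clU']] := regular_open_shrink z _ regT nV'.
exists j, U'; split=> //; first by exists z.
  by move=> u /clU'[[]].
by move=> u /subset_closure/clU'[[]].
Qed.

(** The inductive construction, freed from arithmetic: J i is the set of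
    admissible successors of the index i, and G i j the condition imposed on the
    limit when j is chosen after i.  As J is irreflexive, the L i can be avoided
    even though each U k must meet one of them.  The E k allow a diagonal
    argument against any countable union of closed sets that miss all L i. *)
Lemma nested_refinement {T : topologicalType} (regT : regular_space T)
    (S K : set T) (x0 : T) (I I' : countType) (L : I -> set T)
    (L' : I' -> set T) (J : I -> set I) (G : I -> I -> set T)
    (E : nat -> set T) :
    S x0 -> compact K -> nbhs x0 K -> closure S `&` K `<=` S ->
    (forall i, closed_in S (L i)) -> (forall i, closed_in S (L' i)) ->
    closure (\bigcup_i L i) x0 ->
    (forall i, ~ J i i) ->
    (forall i, L i `<=` closure (\bigcup_(j in J i) (L i `&` L j))) ->
    (forall i (F : set I) (F' : set I'),
        finite_set F -> finite_set F' -> ~ F i ->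
        L i `<=` closure
          (L i `\` (\bigcup_(k in F) L k `|` \bigcup_(k in F') L' k))) ->
    (forall i j x, J i j -> L i x -> nbhs x (G i j)) ->
    (forall k, closed (E k)) -> (forall k i, L i `&` E k = set0) ->
  exists xi (i_ : nat -> I),
    [/\ S xi, forall i, ~ L i xi, forall i, ~ L' i xi, forall k, ~ E k xi &
        forall k, J (i_ k) (i_ k.+1) /\ G (i_ k) (i_ k.+1) xi].
Proof.
move=> Sx0 cK nK SK Lc L'c dL Jirr Hb Hc nG cE LE0.
have LS i : L i `<=` S.
  by move=> x; rewrite -(closed_in_setI_closure _ _ (Lc i)) => -[].
(* L l and L' l are closed only in S; replacing them by their closures adds no
   point of S and makes the set to avoid at step k closed. *)
pose bad k j : set T :=
  \bigcup_(l in [set l | (pickle l <= k)%N /\ l <> j]) closure (L l)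
  `|` \bigcup_(l in [set l | (pickle l <= k)%N]) closure (L' l) `|` E k.
have fin_pickle (C : countType) k (P : set C) :
    P `<=` [set l | (pickle l <= k)%N] -> finite_set P.
  move=> Pk; apply: (@sub_finite_set _ _ (pickle @^-1` `I_k.+1)) => //.
  apply: finite_preimage (finite_II _) => x y _ _.
  exact: (pcan_inj (@pickleK C)).
have bad_closed k j : closed (bad k j).
  apply: closedU => //.
  by apply: closedU; apply: closed_bigcup => [|l _]; try exact: closed_closure;
    apply: (fin_pickle _ k) => l // [].
have badP k j : L j `<=` closure (L j `\` bad k j).
  pose F : set I := [set l | (pickle l <= k)%N /\ l <> j].
  pose F' : set I' := [set l | (pickle l <= k)%N].
  move=> x Ljx; apply: closureS (Hc j F F' _ _ _ x Ljx); last first.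
  - by case.
  - by apply: (fin_pickle _ k).
  - by apply: (fin_pickle _ k) => l [].
  move=> y [Ljy nF]; split=> //; have Sy := LS _ _ Ljy; case.
    case=> -[l Fl cly]; apply: nF; [left|right]; exists l => //.
      by rewrite -(closed_in_setI_closure _ _ (Lc l)).
    by rewrite -(closed_in_setI_closure _ _ (L'c l)).
  by move=> Ey; have : (L j `&` E k) y by []; rewrite LE0.
pose P (s : I * set T) := [/\ open s.2, s.2 `&` L s.1 !=set0 & s.2 `<=` K].
pose Q k (s s' : I * set T) := [/\ J s.1 s'.1, closure s'.2 `<=` s.2 &
  s'.2 `<=` G s.1 s'.1 `\` bad k s'.1].
have [i0 Pi0] : exists i0, P (i0, K°).
  have [x [[i _ Lix] Kx]] := dL _ (nbhs_interior nK).
  exists i; split; [exact: open_interior | by exists x | exact: interior_subset].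
have [k [i U] [/= oU UL UK]|f fPQ] := dependent_choice_nat P Q _ Pi0.
  have [j [U' [Jij oU' U'L clU' U'G]]] :=
    open_refinement regT L i U (J i) (G i) (bad k) oU UL (Hb i)
      (fun j x => nG i j x) (fun j _ => bad_closed k j) (fun j _ => badP k j).
  exists (j, U') => //; split=> //=.
  by apply: subset_trans UK; apply: subset_trans clU'; exact: subset_closure.
have Jf k : J (f k).1 (f k.+1).1 by have [_ []] := fPQ k.
have [|||xi [Sxi Kxi Uxi]] := nested_open_compact S K (fun k => (f k).2) cK.
- by have [[]] := fPQ 0%N.
- by move=> k; have [_ []] := fPQ k.
- move=> k; have [[_ [x [Ux Lx]] _] _] := fPQ k.
  by exists x; split=> //; exact: LS Lx.
have nbad k : ~ bad k (f k.+1).1 xi.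
  by have [_ [_ _ /(_ xi (Uxi k.+1)) []]] := fPQ k.
exists xi, (fun k => (f k).1); split.
- exact: SK.
- move=> i Lixi; pose k := pickle i.
  (* Step k avoids L i unless it chooses the index i, in which case step k+1
     chooses another one. *)
  have cLi := subset_closure Lixi.
  have [e|ne] := eqVneq i (f k.+1).1.
    apply: (nbad k.+1); left; left; exists i => //; split; first exact: leqnSn.
    by move=> e'; apply: (Jirr i); rewrite {1}e e'; exact: Jf.
  by apply: (nbad k); left; left; exists i => //; split=> //; exact/eqP.
- move=> i Lixi; apply: (nbad (pickle i)); left; right; exists i => //=.
  exact: subset_closure.
- by move=> k Ek; apply: (nbad k); right.
- move=> k; split; first exact: Jf.
  by have [_ [_ _ /(_ xi (Uxi k.+1)) []]] := fPQ k.
Qed.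

(** * Rational affine hyperplanes *)

Lemma dist_int_le {R : realType} (x : R) (k : int) :
  dist_int x <= `|x - k%:~R|.
Proof.
have lb : has_lbound [set `|x - l%:~R| | l in [set: int]].
  by exists 0 => _ [l _ <-].
by apply: (ge_inf lb); exists k.
Qed.

Lemma dotZ_continuous {R : realType} {n : nat} (q : 'rV[int]_n) :
  continuous (dotZ q : 'rV[R]_n -> R).
Proof.
apply: continuous_big => [|i _ x]; first exact: (@add_continuous R^o).
apply: (@cvgM _ _ (nbhs x) _ (fun=> (q 0 i)%:~R) _ (q 0 i)%:~R (x 0 i)).
  exact: cvg_cst.
exact: coord_continuous.
Qed.

Lemma near_hyperplane {R : realType} {n : nat} (m : 'rV[int]_n.+1)
    (x : 'rV[R]_n) (e : R) :
    hyperplane_of m x -> 0 < e ->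
  \forall y \near x, dist_int (dotZ (normal_part m) y) <= e.
Proof.
move=> mx e0.
have /cvgrPdist_le /(_ e e0) := @dotZ_continuous R n (normal_part m) x.
apply: filterS => y.
rewrite [dotZ _ x]mx distrC; exact/le_trans/dist_int_le.
Qed.

(** Multiply by the denominators, then divide by the greatest common divisor. *)
Lemma primitive_multiple {n : nat} (v : 'rV[rat]_n) :
    v != 0 ->
  exists m : 'rV[int]_n, exists2 r : rat, r != 0 &
    primitive m /\ forall i, (m 0 i)%:~R = r * v 0 i.
Proof.
move=> v0.
pose d : int := \prod_(i < n) denq (v 0 i).
have d0 : d != 0 by apply/prodf_neq0 => i _; exact: denq_neq0.
pose a i : int := numq (v 0 i) * \prod_(j < n | j != i) denq (v 0 j).
have aE i : (a i)%:~R = d%:~R * v 0 i.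
  have -> : d = denq (v 0 i) * \prod_(j < n | j != i) denq (v 0 j).
    by rewrite /d (bigD1 i).
  by rewrite !intrM mulrAC [_ * v 0 i]mulrC numqE.
pose g := \big[gcdn/0%N]_(i < n) absz (a i).
have gdvd i : (g %| absz (a i))%N by apply: (@biggcdn_inf _ i).
have g0 : (0 < g)%N.
  have /rV0Pn[k vk0] := v0.
  apply: dvdn_gt0 (gdvd k); rewrite absz_gt0 -(intr_eq0 rat) aE.
  by rewrite mulf_neq0 // intr_eq0.
have gR0 : g%:Z%:~R != 0 :> rat by rewrite intr_eq0 -lt0n.
pose m : 'rV[int]_n := \row_i (a i %/ g)%Z.
have mg i : m 0 i * g = a i by rewrite mxE divzK // dvdzE.
exists m, (d%:~R / g%:Z%:~R); first by rewrite mulf_neq0 ?invr_eq0 // intr_eq0.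
split=> [|i]; last first.
  by rewrite mulrAC -aE -mg intrM mulfK.
apply/eqP; rewrite -(eqn_pmul2r g0) mul1n; apply/eqP.
rewrite (@big_morph _ _ (muln^~ g) 0%N gcdn) => [|x y|//]; last first.
  by rewrite muln_gcdl.
by apply: eq_bigr => i _; rewrite -mg abszM.
Qed.

Lemma totally_irrational_of_no_hyperplane {R : realType} {n : nat}
    (xi : 'rV[R]_n) :
  (forall B, rational_hyperplane B -> ~ B xi) -> totally_irrational xi.
Proof.
move=> xiB c0 c rel.
have [c_eq0|cN0] := eqVneq c 0.
  split=> //; move: rel; rewrite c_eq0 big1 => [|i _]; last first.
    by rewrite mxE rmorph0 mul0r.
  by rewrite addr0 => /eqP; rewrite fmorph_eq0 => /eqP.
pose v : 'rV[rat]_n.+1 := row_mx (- c0)%:M c.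
have vS i : v 0 (lift ord0 i) = c 0 i.
  by rewrite -(row_mxEr (- c0)%:M c); congr (v 0 _); exact/val_inj.
have v0 : v 0 ord0 = - c0.
  transitivity (row_mx (- c0)%:M c 0 (lshift n 0)).
    by congr (v 0 _); exact/val_inj.
  by rewrite row_mxEl mxE eqxx mulr1n.
have [k ck0] := rV0Pn _ cN0.
have vN0 : v != 0 by apply/rV0Pn; exists (lift ord0 k); rewrite vS.
have [m [r r0 [pm mE]]] := primitive_multiple v vN0.
case: (xiB (hyperplane_of m)).
  exists m; split=> //; apply/rV0Pn; exists k.
  by rewrite mxE -(intr_eq0 rat) mE vS mulf_neq0.
have ratrE (z : int) : z%:~R = ratr z%:~R :> R by rewrite ratr_int.
rewrite /hyperplane_of /= ratrE mE v0 rmorphM rmorphN.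
under eq_bigr => i _ do rewrite mxE ratrE mE vS rmorphM -mulrA.
rewrite -mulr_sumr; congr (_ * _).
by apply/eqP; rewrite -subr_eq0 opprK addrC rel.
Qed.

Lemma totally_irrational_not_in_hyperplane {R : realType} {n : nat}
    (B : set 'rV[R]_n) (xi : 'rV[R]_n) :
  rational_hyperplane B -> B xi -> ~ totally_irrational xi.
Proof.
move=> [m [_ m0 ->]] mxi /(_ (- (m 0 ord0)%:~R) (\row_i (normal_part m 0 i)%:~R)).
case.
  rewrite rmorphN /= ratr_int; apply/eqP; rewrite addrC subr_eq0 -mxi; apply/eqP.
  by apply: eq_bigr => i _; rewrite mxE ratr_int.
move=> _ /rowP mE; case/eqP: m0; apply/rowP => i.
by have /eqP := mE i; rewrite !mxE intr_eq0 => /eqP.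
Qed.

(** Turns the largeness of |A j| provided by the density hypothesis into the
    growth of Phi along the chosen normal vectors. *)
Lemma Phi_gt_of_sup_norm_large {R : realType} {n : nat}
    (Phi : 'rV[int]_n -> R) (C : R) :
    finite_set [set q : 'rV[int]_n | q != 0 /\ Phi q <= C] ->
  exists2 T : R, 0 < T & forall q, q != 0 -> T < (sup_norm q)%:R -> C < Phi q.
Proof.
move=> /finite_seqP[s sE].
exists (\max_(q <- s) sup_norm q).+1%:R => [//|q q0].
rewrite ltr_nat ltNge => ltq; apply/negP => qC.
have qs : q \in s by have : [set` s] q by rewrite -sE.
by have := leq_bigmax_seq (F := @sup_norm n) q qs isT; rewrite leqNgt (ltnW ltq).
Qed.

(** * Totally irrational points with a prescribed rate of approximation *)

Theorem theorem1p1 (R : realType) (n : nat) (hn : (2 <= n)%N)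
  (S : set 'rV[R]_n) (S_neq0 : S !=set0) (S_lc : locally_closed S)
  (I I' : countType) (L : I -> set 'rV[R]_n) (L' : I' -> set 'rV[R]_n)
  (L_inj : injective L) (L'_inj : injective L')
  (LL'_disj : forall i j, L i <> L' j)
  (L_closed : forall i, closed_in S (L i))
  (L'_closed : forall j, closed_in S (L' j))
  (A : I -> set 'rV[R]_n)
  (A_rat : forall i, rational_hyperplane (A i))
  (L_sub : forall i, L i `<=` A i)
  (L'_sub : forall j, exists2 B, rational_hyperplane B & L' j `<=` B)
  (Ha : \bigcup_i L i `|` \bigcup_j L' j =
        [set x | S x /\ exists2 B, rational_hyperplane B & B x])
  (Hb : forall (i : I) (T : R), 0 < T ->
        L i = closure_in S
                (\bigcup_(j in [set j | T < (height (A j))%:R]) (L i `&` L j)))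
  (Hc : forall (i : I) (F : set I) (F' : set I'),
        finite_set F -> finite_set F' -> ~ F i ->
        L i = closure_in S
                (L i `\` (\bigcup_(k in F) L k `|` \bigcup_(k in F') L' k)))
  (Hd : closure_in S (\bigcup_i L i) = S) :
  forall Phi : 'rV[int]_n -> R,
    (forall q : 'rV[int]_n, q != 0 -> 0 < Phi q) ->
    (forall C : R, 0 < C -> finite_set [set q : 'rV[int]_n | q != 0 /\ Phi q <= C]) ->
  forall phi : R -> R,
    (forall t : R, 0 < t -> 0 < phi t) ->
    (forall s t : R, 0 < s -> s <= t -> phi t <= phi s) ->
  ~ countable [set xi | [/\ S xi, totally_irrational xi &
                            \forall t \near +oo, psi Phi xi t <= phi t]].
Proof.
move=> Phi Phi_gt0 Phi_fin phi phi_gt0 phi_dec.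
set X := [set xi | _] => /countable_injP[f f_inj].
have [m mA] := choice A_rat.
pose q i := normal_part (m i).
have q0 i : q i != 0 by have [] := mA i.
have Lm i : L i `<=` hyperplane_of (m i).
  by move=> x /L_sub; have [_ _ ->] := mA i.
have [W oW SE] := S_lc.
have [x0 Sx0] := S_neq0.
have [K [cK nK KW]] : exists K, [/\ compact K, nbhs x0 K & K `<=` W].
  apply: rV_nbhs_compact; apply: open_nbhs_nbhs; split=> //.
  by move: Sx0; rewrite SE => -[].
have Phi_q i : 0 < Phi (q i) by exact: Phi_gt0.
(* The summand 1 forces Phi (q (i_ k)) to tend to infinity, so that the
   intervals between consecutive values cover all large t. *)
pose J i : set I := [set j | Phi (q i) + 1 < Phi (q j)].
pose G i j : set 'rV[R]_n := [set x | dist_int (dotZ (q i) x) <= phi (Phi (q j))].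
(* X is spread over the sets E k, each with at most one point, so that a limit
   avoiding every E k lies outside X. *)
pose E k := X `&` [set x | f x = k].
have [||||||||xi [i_ [Sxi Lxi L'xi Exi /all_and2[Jxi Gxi]]]] :=
  nested_refinement uniform_regular S K x0 I I' L L' J G E Sx0 cK nK _
    L_closed L'_closed.
- by move=> x [Sx Kx]; rewrite SE; split=> //; exact: KW.
- by move: Sx0; rewrite -{1}Hd => -[].
- by move=> i; rewrite /J /= ltNge lerDl ler01.
- move=> i x Lx.
  have [T T0 TJ] :=
    Phi_gt_of_sup_norm_large Phi _ (Phi_fin _ (addr_gt0 (Phi_q i) ltr01)).
  move: Lx; rewrite {1}(Hb i T T0) => -[_]; apply: closureS.
  move=> y [j Tj Ly]; exists j => //; apply: TJ => //.
  by rewrite -(heightE (mA j)).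
- by move=> i F F' fF fF' Fi x; rewrite {1}(Hc i F F' fF fF' Fi) => -[].
- move=> i j x _ Lx; apply: near_hyperplane; [exact: Lm | exact: phi_gt0].
- move=> k; have [->|/set0P[x Ex]] := eqVneq (E k) set0; first exact: closed0.
  suff -> : E k = [set x].
    apply: accessible_closed_set1; apply: hausdorff_accessible.
    exact: norm_hausdorff.
  apply/seteqP; split=> [y [Xy fy]|_ -> //]; case: Ex => Xx fx.
  by apply: f_inj; rewrite ?inE // fy fx.
- move=> k i; apply/seteqP; split=> // x [Lx [[_ irr _] _]].
  by apply: totally_irrational_not_in_hyperplane (A_rat i) _ irr; exact: L_sub.
(* It remains to see that xi itself belongs to X. *)
apply: (Exi (f xi)); split=> //; split=> //.
  apply: totally_irrational_of_no_hyperplane => B ratB Bxi.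
  have : [set x | S x /\ exists2 B, rational_hyperplane B & B x] xi.
    by split=> //; exists B.
  by rewrite -Ha => -[[i _ /Lxi]|[i _ /L'xi]].
have Phi_large k : k%:R < Phi (q (i_ k)).
  elim: k => [|k IH]; first exact: Phi_q.
  by rewrite -natr1; apply: lt_trans (Jxi k); rewrite ltrD2r.
near=> t.
have t0 : Phi (q (i_ 0%N)) <= t.
  by near: t; apply: nbhs_pinfty_ge; exact: num_real.
have t_gt0 : 0 < t := lt_le_trans (Phi_q _) t0.
have [k kt tk] : exists2 k, Phi (q (i_ k)) <= t & t < Phi (q (i_ k.+1)).
  have ex_k : exists k, t < Phi (q (i_ k)).
    exists (Num.bound t); apply: lt_trans (Phi_large _).
    exact/archi_boundP/ltW.
  case: (ex_minnP ex_k) => -[|k] tk k_min; first by rewrite ltNge t0 in tk.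
  exists k => //; rewrite leNgt; apply/negP => /k_min.
  by rewrite ltnn.
have val : psi_values Phi xi t (dist_int (dotZ (q (i_ k)) xi)).
  by exists (q (i_ k)).
have [_ /(_ _ val) psi_le] := psiP (Phi_fin _ t_gt0) (ex_intro _ _ val).
apply: le_trans psi_le _; apply: le_trans (Gxi k) _.
by apply: phi_dec => //; exact: ltW.
Unshelve. all: by end_near.
Qed.
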